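(* Let $k\ge1$ be an integer and let $PT_k(z)=\sum_{i\ge 0}|\mathcal{PM}_{F_{k,i}}|\,z^i$ be the generating function of prefix $k$-Fibonacci paths by length. Then, as formal power series, \[ PT_k(z)=\frac{(1-2z)(1-kz-z^2)-z-\sqrt{(1-(k+1)z-z^2)^2-4z^2(1-kz-z^2)^2}}{2z\big((1-kz-z^2)(2z-1)+z\big)}, \] and for every integer $t\ge0$, \[ [z^t]\,PT_k(z)=\sum_{n=0}^{t}\sum_{m=0}^{t}\sum_{l=0}^{t-2m-n}\frac{n+1}{n+m+1}\binom{n+2m+l}{m,\,l,\,m+n}F_{k,t-2m-n-l+1}^{(l)} . \]
   Context: For a positive integer $k$, the $k$-Fibonacci numbers are defined by $F_{k,0}=0$, $F_{k,1}=1$, $F_{k,n+1}=kF_{k,n}+F_{k,n-1}$ for $n\ge1$. A prefix $k$-Fibonacci path of length $n$ is a lattice path in $\mathbb{Z}\times\mathbb{Z}$ starting at $(0,0)$ and ending at some point $(n,j)$ with $j\ge0$, never passing below the $x$-axis, built from rise steps $U=(1,1)$, fall steps $D=(1,-1)$, and horizontal steps $H_l=(l,0)$ for any positive integer $l$, where each step $H_l$ is additionally assigned one of $F_{k,l}$ colors (differently colored paths are counted as different). $\mathcal{PM}_{F_{k,n}}$ denotes the set of such colored paths of length $n$; the empty path is the unique one of length $0$. The convolved $k$-Fibonacci numbers $F^{(r)}_{k,j}$ (for integers $r\ge0$, $j\ge1$) are defined by $(1-kx-x^2)^{-r}=\sum_{j\ge0}F^{(r)}_{k,j+1}x^j$.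 $\binom{a}{b,c,d}=\frac{a!}{b!\,c!\,d!}$ for $b+c+d=a$ is the multinomial coefficient; sums with upper limit below the lower limit are empty. The square root denotes the formal power series square root with constant term $1$. *)

(* Defs.v *)
From HB Require Import structures.
From mathcomp Require Import all_boot all_order all_algebra.
From mathcomp Require Import finmap.
From mathcomp Require Import boolp classical_sets functions cardinality.

Set Implicit Arguments.
Unset Strict Implicit.
Unset Printing Implicit Defensive.

Import Order.TTheory GRing.Theory Num.Theory.
Local Open Scope ring_scope.

(* Formal power series over a field. The record keeps the Cauchy product
   apart from the pointwise ring structure that `functions` puts on nat -> F. *)
Record fps (F : fieldType) := Fps { fps_coef : nat -> F }.

Notation "'[z^ n ] a" := (fps_coef a n)
  (at level 8, n at level 99, a at level 2) : ring_scope.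

HB.instance Definition _ (F : fieldType) := gen_eqMixin (fps F).
HB.instance Definition _ (F : fieldType) := gen_choiceMixin (fps F).

(* covrec f n = f [:: covrec f 0; ...; covrec f n.-1] *)
Section CourseOfValues.
Variables (T : Type) (f : seq T -> T).

Fixpoint covseq n : seq T :=
  if n is m.+1 then rcons (covseq m) (f (covseq m)) else [::].

Definition covrec n := f (covseq n).

Lemma covseqE n : covseq n = mkseq covrec n.
Proof. by elim: n => [|n IHn] //; rewrite mkseqS -IHn. Qed.

Lemma size_covseq n : size (covseq n) = n.
Proof. by rewrite covseqE size_mkseq. Qed.

Lemma nth_covseq x0 n i : (i < n)%N -> nth x0 (covseq n) i = covrec i.
Proof. by move=> lt_in; rewrite covseqE nth_mkseq. Qed.

End CourseOfValues.

Section FpsRing.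
Variable F : fieldType.
Implicit Types a b c : fps F.

Lemma fpsP a b : (forall n, '[z^n] a = '[z^n] b) <-> a = b.
Proof.
by split=> [|->//]; case: a b => [a] [b] /= eq_ab; congr Fps; apply/funext.
Qed.

Definition fps_zero : fps F := Fps (fun=> 0).
Definition fps_opp a : fps F := Fps (fun n => - '[z^n] a).
Definition fps_add a b : fps F := Fps (fun n => '[z^n] a + '[z^n] b).
Definition fps_one : fps F := Fps (fun n => (n == 0%N)%:R).
Definition fps_mul a b : fps F :=
  Fps (fun n => \sum_(i < n.+1) '[z^i] a * '[z^(n - i)%N] b).

Fact fps_addA : associative fps_add.
Proof. by move=> a b c; apply/fpsP => n /=; rewrite addrA. Qed.
Fact fps_addC : commutative fps_add.
Proof. by move=> a b; apply/fpsP => n /=; rewrite addrC. Qed.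
Fact fps_add0 : left_id fps_zero fps_add.
Proof. by move=> a; apply/fpsP => n /=; rewrite add0r. Qed.
Fact fps_addN : left_inverse fps_zero fps_opp fps_add.
Proof. by move=> a; apply/fpsP => n /=; rewrite addNr. Qed.

HB.instance Definition _ := GRing.isZmodule.Build (fps F)
  fps_addA fps_addC fps_add0 fps_addN.

Let trunc n a : {poly F} := \poly_(i < n.+1) '[z^i] a.

Let coef_trunc n a i : (i <= n)%N -> (trunc n a)`_i = '[z^i] a.
Proof. by move=> le_in; rewrite coef_poly ltnS le_in. Qed.

Let coef_truncM n a b i : (i <= n)%N ->
  (trunc n a * trunc n b)`_i = '[z^i] (fps_mul a b).
Proof.
move=> le_in; rewrite coefM; apply: eq_bigr => j _.
rewrite !coef_trunc //; first exact: leq_trans (leq_subr _ _) le_in.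
by rewrite (leq_trans _ le_in) // -ltnS.
Qed.

Fact fps_mulA : associative fps_mul.
Proof.
move=> a b c; apply/fpsP => n.
have le_ord (i : 'I_n.+1) : (i <= n)%N by rewrite -ltnS.
transitivity ((trunc n a * (trunc n b * trunc n c))`_n).
  rewrite coefM; apply: eq_bigr => i _.
  by rewrite coef_trunc // coef_truncM // leq_subr.
rewrite mulrA coefM; apply: eq_bigr => i _.
by rewrite coef_truncM // coef_trunc // leq_subr.
Qed.

Fact fps_mulC : commutative fps_mul.
Proof. by move=> a b; apply/fpsP => n; rewrite -!(@coef_truncM n) // mulrC. Qed.

Fact fps_mul1 : left_id fps_one fps_mul.
Proof.
move=> a; apply/fpsP => n /=; rewrite big_ord_recl /= mul1r subn0.
by rewrite big1 ?addr0 // => i _; rewrite mul0r.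
Qed.

Fact fps_mulDl : left_distributive fps_mul fps_add.
Proof.
move=> a b c; apply/fpsP => n /=; rewrite -big_split.
by apply: eq_bigr => i _; rewrite mulrDl.
Qed.

Fact fps_one_neq0 : fps_one != 0.
Proof. by apply/eqP => /fpsP/(_ 0%N)/eqP; rewrite oner_eq0. Qed.

HB.instance Definition _ := GRing.Zmodule_isComNzRing.Build (fps F)
  fps_mulA fps_mulC fps_mul1 fps_mulDl fps_one_neq0.

Lemma fps_coef0 n : '[z^n] (0 : fps F) = 0. Proof. by []. Qed.
Lemma fps_coef1 n : '[z^n] (1 : fps F) = (n == 0%N)%:R. Proof. by []. Qed.
Lemma fps_coefD n a b : '[z^n] (a + b) = '[z^n] a + '[z^n] b. Proof. by []. Qed.
Lemma fps_coefN n a : '[z^n] (- a) = - '[z^n] a. Proof. by []. Qed.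
Lemma fps_coefM n a b :
  '[z^n] (a * b) = \sum_(i < n.+1) '[z^i] a * '[z^(n - i)%N] b.
Proof. by []. Qed.

Lemma fps_coef0M a b : '[z^0] (a * b) = '[z^0] a * '[z^0] b.
Proof. by rewrite fps_coefM big_ord1. Qed.

(* The n-th coefficient of 1 / a from the list s of the previous ones. *)
Definition fps_inv_next a (s : seq F) : F :=
  ((size s == 0%N)%:R - \sum_(i < size s) s`_i * '[z^(size s - i)%N] a)
  / '[z^0] a.

Definition fps_unit : {pred fps F} := [pred a | '[z^0] a != 0].

Definition fps_inv a : fps F :=
  if '[z^0] a == 0 then a else Fps (covrec (fps_inv_next a)).

Fact fps_mulV : {in fps_unit, left_inverse 1 fps_inv *%R}.
Proof.
move=> a; rewrite inE => a0_neq0; apply/fpsP => n.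
rewrite /fps_inv (negPf a0_neq0) fps_coefM big_ord_recr /= subnn.
rewrite {2}/covrec {2}/fps_inv_next size_covseq divfK //.
set u := \sum_(i < n) _; set v := \sum_(i < n) _.
suff -> : v = u by rewrite addrC subrK.
by apply: eq_bigr => i _; rewrite nth_covseq.
Qed.

Fact fps_unitP a b : b * a = 1 -> fps_unit a.
Proof.
move=> /fpsP/(_ 0%N); rewrite fps_coef0M fps_coef1 => ba1.
by apply/eqP => a0; move/eqP: ba1; rewrite a0 mulr0 eq_sym oner_eq0.
Qed.

Fact fps_inv_out : {in [predC fps_unit], fps_inv =1 id}.
Proof. by move=> a; rewrite !inE negbK /fps_inv => ->. Qed.

HB.instance Definition _ := GRing.ComNzRing_hasMulInverse.Build (fps F)
  fps_mulV fps_unitP fps_inv_out.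

Lemma fps_neq0P a :
  a != 0 -> exists n, '[z^n] a != 0 /\ forall i, (i < n)%N -> '[z^i] a = 0.
Proof.
move=> a_neq0; have [n an_neq0] : exists n, '[z^n] a != 0.
  apply: contrapT => /forallNP all0; case/eqP: a_neq0; apply/fpsP => n.
  by apply/eqP; move/negP: (all0 n); rewrite negbK.
have exn : exists n, '[z^n] a != 0 by exists n.
case: (ex_minnP exn) => m am_neq0 min_m; exists m; split=> // i lt_im.
by apply/eqP; apply: contraLR lt_im => /min_m; rewrite leqNgt.
Qed.

Fact fps_integral : GRing.integral_domain_axiom (fps F).
Proof.
move=> a b ab0; apply: contraT; rewrite negb_or => /andP[].
move=> /fps_neq0P[m [am_neq0 am0]] /fps_neq0P[n [bn_neq0 bn0]].
have lt_m : (m < (m + n).+1)%N by rewrite ltnS leq_addr.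
move/fpsP/(_ (m + n)%N): ab0; rewrite fps_coefM (bigD1 (Ordinal lt_m)) //=.
rewrite addKn big1 ?addr0 => [/eqP|i ne_im].
  by rewrite mulf_eq0 (negPf am_neq0) (negPf bn_neq0).
have [lt_im|lt_mi|eq_im] := ltngtP i m.
- by rewrite (am0 i lt_im) mul0r.
- have lt_n : (m + n - i < n)%N.
    by rewrite ltn_subLR ?ltn_add2r // -ltnS ltn_ord.
  by rewrite (bn0 _ lt_n) mulr0.
- by move: ne_im; rewrite -val_eqE /= eq_im eqxx.
Qed.

HB.instance Definition _ :=
  GRing.ComUnitRing_isIntegral.Build (fps F) fps_integral.

Definition fpsX : fps F := Fps (fun n => (n == 1%N)%:R).

(* The n-th coefficient of the square root s of a with '[z^0] s = 1: it solves
   '[z^n] a = 2 * '[z^n] s + \sum_(1 <= i < n) '[z^i] s * '[z^(n - i)] s. *)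
Definition fps_sqrt_next a (s : seq F) : F :=
  if size s == 0%N then 1 else
  ('[z^(size s)] a - \sum_(1 <= i < size s) s`_i * s`_(size s - i)) / 2.

Definition fps_sqrt a : fps F := Fps (covrec (fps_sqrt_next a)).

Lemma fps_sqrt_coef0 a : '[z^0] (fps_sqrt a) = 1.
Proof. by []. Qed.

Lemma fps_sqrtK a :
  2%:R != 0 :> F -> '[z^0] a = 1 -> fps_sqrt a ^+ 2 = a.
Proof.
move=> two_neq0 a0; apply/fpsP => -[|n].
  by rewrite expr2 fps_coef0M fps_sqrt_coef0 mulr1 a0.
have sqrtS : '[z^n.+1] (fps_sqrt a) = ('[z^n.+1] a
    - \sum_(1 <= i < n.+1) '[z^i] (fps_sqrt a) * '[z^(n.+1 - i)%N] (fps_sqrt a)) / 2.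
  rewrite [LHS]/= /covrec /fps_sqrt_next size_covseq; congr ((_ - _) / 2).
  apply: eq_big_nat => i /andP[i_gt0 lt_in].
  by rewrite !nth_covseq // ltn_subrL i_gt0.
have split_sum (G : nat -> F) : \sum_(i < n.+2) G i =
    G 0%N + G n.+1 + \sum_(1 <= i < n.+1) G i.
  by rewrite -(big_mkord xpredT) big_nat_recr // big_ltn //= addrAC.
rewrite expr2 fps_coefM (split_sum (fun i =>
  '[z^i] (fps_sqrt a) * '[z^(n.+1 - i)%N] (fps_sqrt a))).
rewrite subn0 subnn fps_sqrt_coef0 mul1r mulr1 -mulr2n -mulr_natl.
by rewrite sqrtS mulrC divfK // subrK.
Qed.

Lemma fps_sqrt_uniq a s :
  2%:R != 0 :> F -> '[z^0] s = 1 -> s ^+ 2 = a -> s = fps_sqrt a.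
Proof.
move=> two_neq0 s0 sa.
have a0 : '[z^0] a = 1 by rewrite -sa expr2 fps_coef0M s0 mulr1.
have /eqP := subrr a; rewrite -{1}sa -{1}(fps_sqrtK two_neq0 a0) subr_sqr.
rewrite mulf_eq0 => /orP[|/eqP/fpsP/(_ 0%N)/eqP].
  by rewrite subr_eq0 => /eqP.
by rewrite fps_coefD s0 fps_sqrt_coef0 fps_coef0 -[1 + 1]/(2%:R) (negPf two_neq0).
Qed.

End FpsRing.

Arguments fpsX {F}.

Fixpoint kfib_pair (k n : nat) : nat * nat :=
  if n is m.+1 then
    let: (u, v) := kfib_pair k m in (v, k * v + u)%N
  else (0%N, 1%N).

Definition kfib (k n : nat) : nat := (kfib_pair k n).1.

Lemma kfib0 k : kfib k 0 = 0%N. Proof. by []. Qed.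
Lemma kfib1 k : kfib k 1 = 1%N. Proof. by []. Qed.
Lemma kfibSS k n : kfib k n.+2 = (k * kfib k n.+1 + kfib k n)%N.
Proof. by rewrite /kfib /=; case: kfib_pair. Qed.

(* 1 - k z - z^2 *)
Definition kfib_den (k : nat) : fps rat := 1 - k%:R * fpsX - fpsX ^+ 2.

Lemma kfib_den_unit k : kfib_den k \is a GRing.unit.
Proof.
rewrite -[_ \is a _]/('[z^0] (kfib_den k) != 0) /kfib_den.
by rewrite !fps_coefD !fps_coefN expr2 !fps_coef0M !mulr0 !subr0.
Qed.

(* F^(r)_{k,j} for j >= 1; the value at j = 0 is irrelevant. *)
Definition conv_kfib (k r j : nat) : rat := '[z^j.-1] (kfib_den k ^- r).

Definition trinomial (a b c d : nat) : rat := a`!%:R / (b`! * c`! * d`!)%:R.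

(* Horiz l c is the step (l, 0) with color c; the case l = 0 is void since
   kfib k 0 = 0. *)
Inductive step (k : nat) :=
| Up
| Down
| Horiz (l : nat) (c : 'I_(kfib k l)).
Arguments Up {k}.
Arguments Down {k}.
Arguments Horiz {k} l c.

Section StepCount.
Variable k : nat.

Definition step_code (s : step k) : bool + {l : nat & 'I_(kfib k l)} :=
  match s with
  | Up => inl true
  | Down => inl false
  | Horiz l c => inr (Tagged (fun l => 'I_(kfib k l)) c)
  end.

Definition step_decode (u : bool + {l : nat & 'I_(kfib k l)}) : step k :=
  match u with
  | inl b => if b then Up else Down
  | inr v => Horiz (tag v) (tagged v)
  end.

Lemma step_codeK : cancel step_code step_decode.
Proof. by case. Qed.

HB.instance Definition _ := Countable.copy (step k) (can_type step_codeK).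

End StepCount.

Definition displacement (k : nat) (s : step k) : int * int :=
  match s with
  | Up => (1, 1)
  | Down => (1, -1)
  | Horiz l _ => (l%:Z, 0)
  end.

Definition endpoint (k : nat) (p : seq (step k)) : int * int :=
  \sum_(s <- p) displacement s.

(* The vertices of the path p are the endpoints of its prefixes take i p. *)
Definition prefix_kfib_path (k n : nat) : set (seq (step k)) :=
  [set p | (forall i, 0 <= (endpoint (take i p)).2) /\
           exists2 j : int, 0 <= j & endpoint p = (n%:Z, j)]%classic.

Arguments prefix_kfib_path : clear implicits.

Section PathFinite.
Variables (k n : nat).

Let code := (bool + {l : 'I_n.+1 & 'I_(kfib k l)})%type.

Let decode (u : code) : step k :=
  match u with
  | inl b => if b then Up else Down
  | inr v => Horiz (tag v) (tagged v)
  end.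

Let decode_path (p : seq (step k)) m :
  (m <= n)%N -> (endpoint p).1 = m%:Z ->
  exists2 q : seq code, (size q <= m)%N & p = map decode q.
Proof.
rewrite /endpoint; elim: p m => [|s p IHp] m le_mn.
  by exists [::].
rewrite big_cons => /= def_m.
have fst_ge0 : 0 <= (\sum_(j <- p) displacement j).1.
  elim: (p) => [|s' p' IH]; rewrite ?big_nil ?big_cons //=.
  by apply: addr_ge0 => //; case: s'.
have [l l_gt0 def_l] : exists2 l : nat, (0 < l)%N & (displacement s).1 = l%:Z.
  case: s {def_m} => [||[[]//|l] c]; by [exists 1%N | exists l.+1].
have le_lm : (l <= m)%N by rewrite -lez_nat -def_m def_l lerDl.
have [||q le_q ->] := IHp (m - l)%N.
- exact: leq_trans (leq_subr _ _) le_mn.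
- by rewrite -subzn // -def_m def_l addrC addKr.
have [u ->] : exists u, s = decode u.
  case: s def_l {def_m} => [_|_|l' c /= [def_l]].
  - by exists (inl true).
  - by exists (inl false).
  have lt_l : (l' < n.+1)%N by rewrite def_l ltnS (leq_trans le_lm).
  by exists (inr (existT (fun l : 'I_n.+1 => 'I_(kfib k l)) (Ordinal lt_l) c)).
exists (u :: q) => //=; apply: leq_ltn_trans le_q _.
by rewrite ltn_subrL l_gt0 (leq_trans l_gt0).
Qed.

Lemma finite_prefix_kfib_path : finite_set (prefix_kfib_path k n).
Proof.
apply: (@sub_finite_set _ _
  ((fun q : n.-bseq code => map decode q) @` setT)%classic); last first.
  by apply: finite_image; exact: finite_finset.
move=> p [_ [j _ def_p]].
have [//||q le_q ->] := @decode_path p n _; first by rewrite def_p.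
by exists (Bseq le_q).
Qed.

End PathFinite.

Definition PT (k : nat) : fps rat :=
  Fps (fun i => #|` fset_set (prefix_kfib_path k i)|%:R).

(* Main.v *)
(** Let d = 1 - k z - z^2 and h = z / d, the weight of all horizontal steps
    together. Sorting the paths by their last step gives, for the generating
    function N_j of the paths ending at height j,
    N_j = [j = 0] + z N_(j-1) + z N_(j+1) + h N_j, and summing over j,
    PT = 1 + z PT + z (PT - N_0) + h PT. The recurrence has at most one
    solution, namely z^j M^(j+1) where M = 1 + h M + z^2 M^2; hence N_0 = M and
    PT follows by solving a linear equation. With s the square root of the
    theorem, M = 2 d / (d - z + s), whose denominator is a unit.
    Refining the count by the number of steps and of falls leaves only the
    order of the kinds of steps, counted by weighted ballot numbers; these give
    the coefficient formula. *)

Require Import Defs.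
From mathcomp Require Import all_boot all_order all_algebra.
From mathcomp Require Import finmap classical_sets cardinality.
From mathcomp Require Import zify ring.

Import GRing.Theory Num.Theory.
Local Open Scope ring_scope.

(** * Infinite sums of power series *)

Section FpsSum.
Set Implicit Arguments.
Unset Strict Implicit.
Variable F : fieldType.
Implicit Types (a b : fps F) (f g : nat -> fps F).

Lemma fps_coefXM t a :
  '[z^t] (fpsX * a) = if t is u.+1 then '[z^u] a else 0.
Proof.
rewrite fps_coefM big_ord_recl /= mul0r add0r; case: t => [|t].
  by rewrite big_ord0.
by rewrite big_ord_recl /= mul1r subn1 big1 ?addr0 // => i _; rewrite mul0r.
Qed.

Lemma fps_coefXnM m t a :
  '[z^t] (fpsX ^+ m * a) = if (m <= t)%N then '[z^(t - m)] a else 0.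
Proof.
elim: m t => [|m IHm] t; first by rewrite expr0 mul1r subn0.
by rewrite exprS -mulrA fps_coefXM; case: t => [|t] //; rewrite IHm.
Qed.

Lemma fps_coef_natM n t a : '[z^t] (n%:R * a) = n%:R * '[z^t] a.
Proof.
elim: n => [|n IHn]; first by rewrite !mul0r.
by rewrite -natr1 -natr1 !mulrDl !mul1r fps_coefD IHn.
Qed.

Lemma fps_coef_sum (I : Type) (r : seq I) (P : pred I) (f : I -> fps F) t :
  '[z^t] (\sum_(i <- r | P i) f i) = \sum_(i <- r | P i) '[z^t] (f i).
Proof. exact: (big_morph (fun a => '[z^t] a)). Qed.

(** Stronger than local finiteness, but met here: a path with [i] steps, or ending at height [i],
    has length at least [i]. It justifies the truncation in [fps_sum]. *)
Definition summable f := forall i t, (t < i)%N -> '[z^t] (f i) = 0.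

(* Represents the infinite sum of f only when f is summable. *)
Definition fps_sum f : fps F := Fps (fun t => \sum_(i < t.+1) '[z^t] (f i)).

Lemma eq_fps_sum f g : f =1 g -> fps_sum f = fps_sum g.
Proof. by move=> fg; apply/fpsP => t; apply: eq_bigr => i _; rewrite fg. Qed.

Lemma fps_sum_widen f t n : summable f -> (t < n)%N ->
  '[z^t] (fps_sum f) = \sum_(i < n) '[z^t] (f i).
Proof.
move=> sf lt_tn; rewrite /= (big_ord_widen n (fun i => '[z^t] (f i))) //.
rewrite big_mkcond; apply: eq_bigr => i _; case: ltnP => // lt_ti.
by rewrite sf.
Qed.

Lemma fps_sumD f g : fps_sum (fun i => f i + g i) = fps_sum f + fps_sum g.
Proof. by apply/fpsP => t; rewrite /= -big_split. Qed.

Lemma fps_sumM a f : summable f -> fps_sum (fun i => a * f i) = a * fps_sum f.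
Proof.
move=> sf; apply/fpsP => t; rewrite fps_coefM [LHS]exchange_big.
apply: eq_bigr => u _; rewrite (@fps_sum_widen _ _ t.+1) ?mulr_sumr //.
by rewrite ltnS leq_subr.
Qed.

Lemma fps_sum_recl f : summable f ->
  fps_sum f = f 0%N + fps_sum (fun i => f i.+1).
Proof.
move=> sf; apply/fpsP => t.
by rewrite (@fps_sum_widen _ _ t.+2) // big_ord_recl.
Qed.

Lemma summableS f : summable f -> summable (fun i => f i.+1).
Proof. by move=> sf i t lt_ti; apply: sf; apply: ltnW. Qed.

End FpsSum.

(** * Enumeration of paths by their last step *)

Section Paths.
Set Implicit Arguments.
Unset Strict Implicit.
Variable k : nat.

Definition width (x : step k) : nat := if x is Horiz l _ then l else 1.

Definition height_before (x : step k) (j : nat) : nat :=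
  match x with Up => j.-1 | Down => j.+1 | Horiz _ _ => j end.

Definition horiz_steps (t : nat) : seq (step k) :=
  [seq Horiz l c | l <- iota 0 t.+1, c <- enum 'I_(kfib k l)].

Definition last_steps (t j : nat) : seq (step k) :=
  nseq ((0 < t) && (0 < j))%N Up ++ nseq (0 < t)%N Down ++ horiz_steps t.

(** Recursion is on the number of steps [s], since the last step can shorten the length by varying
    amounts. *)
Fixpoint paths (s t j : nat) : seq (seq (step k)) :=
  if s is r.+1 then
    [seq rcons p x | x <- last_steps t j,
                     p <- paths r (t - width x) (height_before x j)]
  else nseq ((t == 0) && (j == 0))%N [::].

Lemma mem_horiz_steps t (x : step k) :
  (x \in horiz_steps t) = if x is Horiz l _ then (l <= t)%N else false.
Proof.
apply/allpairsPdep/idP => [[l [c []]]|].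
  by rewrite mem_iota => ? _ ->; lia.
case: x => // l c le_lt; exists l, c.
by rewrite mem_iota mem_enum; split=> //; lia.
Qed.

Lemma mem_last_steps t j (x : step k) :
  (x \in last_steps t j) = (width x <= t)%N && ((x == Up) ==> (0 < j)%N).
Proof.
rewrite mem_cat mem_nseq mem_cat mem_nseq mem_horiz_steps.
case: x => [||l c]; last by rewrite !andbF andbT.
  by rewrite eqxx andbF !orbF andbT lt0b.
by rewrite eqxx andbF orbF !andbT lt0b.
Qed.

Lemma Horiz_inj (u v : {l : nat & 'I_(kfib k l)}) :
  Horiz (tag u) (tagged u) = Horiz (tag v) (tagged v) -> u = v.
Proof.
by case: u v => l c [l' c'] /= /(congr1 (@step_code k)) [].
Qed.

Lemma uniq_last_steps t j : uniq (last_steps t j).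
Proof.
have uH : uniq (horiz_steps t).
  apply: allpairs_uniq_dep => [|l _|u v _ _ /Horiz_inj //].
    exact: iota_uniq.
  exact: enum_uniq.
rewrite /last_steps; case: (0 < t)%N; case: (0 < j)%N => //=;
  by rewrite ?inE !mem_horiz_steps uH.
Qed.

Lemma uniq_paths s t j : uniq (paths s t j).
Proof.
elim: s t j => [|s IHs] t j /=; first by case: (_ && _).
apply: allpairs_uniq_dep => [|x _|]; [exact: uniq_last_steps|exact: IHs|].
by move=> [x p] [y q] _ _ /= /rcons_inj [-> ->].
Qed.

Lemma endpoint_rcons (p : seq (step k)) x :
  endpoint (rcons p x) = endpoint p + displacement x.
Proof. by rewrite /endpoint -cats1 big_cat big_seq1. Qed.

Definition nonneg_path (p : seq (step k)) :=
  forall i, 0 <= (endpoint (take i p)).2.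

Lemma nonneg_path_rcons p x : nonneg_path (rcons p x) <->
  nonneg_path p /\ 0 <= (endpoint (rcons p x)).2.
Proof.
split=> [pos|[pos end_pos] i].
  split=> [i|]; last by have := pos (size (rcons p x)); rewrite take_size.
  have := pos (minn i (size p)).
  by rewrite -cats1 takel_cat ?geq_minr // take_min take_size.
have [lt_ip|le_pi] := leqP i (size p); first by rewrite -cats1 takel_cat.
by rewrite take_oversize // size_rcons.
Qed.

Lemma mem_paths s t j (p : seq (step k)) : p \in paths s t j <->
  [/\ size p = s, nonneg_path p & endpoint p = (t%:Z, j%:Z)].
Proof.
elim: s t j p => [|s IHs] t j p.
  rewrite /= mem_nseq; split.
    case/andP; rewrite lt0b => /andP[/eqP -> /eqP ->] /eqP ->.
    by split=> [|i|] //; rewrite /endpoint big_nil.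
  by case=> /size0nil -> _; rewrite /endpoint big_nil => -[<- <-].
split=> [/allpairsPdep[x [q]]|].
  rewrite mem_last_steps => -[/andP[le_xt ok_x] /IHs [sz_q pos_q end_q] ->].
  have end_qx : endpoint (rcons q x) = (t%:Z, j%:Z).
    rewrite endpoint_rcons end_q.
    by case: x le_xt ok_x {end_q} => [||l c] /= *; congr (_, _) => /=; lia.
  split=> /=; [by rewrite size_rcons sz_q | | exact: end_qx].
  by apply/nonneg_path_rcons; rewrite end_qx.
case/lastP: p => [[] //|q x [/eqP]]; rewrite size_rcons eqSS => /eqP sz_q.
move=> /nonneg_path_rcons [pos_q _]; rewrite endpoint_rcons => end_qx.
(* Both coordinates before the last step are nonnegative, hence natural numbers, as the induction
   hypothesis requires. *)
have := pos_q (size q); rewrite take_size => end_q_ge0.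
have fst_ge0 : 0 <= (endpoint q).1.
  rewrite /endpoint; elim: (q) => [|y r IH]; rewrite ?big_nil ?big_cons //=.
  by apply: addr_ge0 => //; case: y.
move: end_q_ge0 fst_ge0 end_qx; case def_q: (endpoint q) => [a b] /= b_ge0 a_ge0.
move=> end_qx; apply/allpairsPdep; exists x, q; split=> //.
  rewrite mem_last_steps.
  by case: x end_qx => [||l c] /= [? ?]; rewrite ?eqxx /=; lia.
apply/IHs; split=> //; rewrite def_q.
by case: x end_qx => [||l c] /= [? ?]; congr (_, _); lia.
Qed.

Lemma endpoint_bound (p : seq (step k)) :
  (size p)%:Z <= (endpoint p).1 /\ (endpoint p).2 <= (size p)%:Z.
Proof.
rewrite /endpoint; elim: p => [|x p]; rewrite ?big_nil // big_cons.
case: (\sum_(y <- p) displacement y) => a b /= [le_pa le_bp].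
(* A horizontal step of length 0 would break the first bound, but it has no color. *)
by case: x => [||[[]//|l] c] /=; lia.
Qed.

Lemma paths_nil s t j : (t < s)%N || (s < j)%N -> paths s t j = [::].
Proof.
move=> out; case def_L: (paths s t j) => [//|p L].
have /mem_paths[sz_p _ end_p] : p \in paths s t j by rewrite def_L mem_head.
by have := endpoint_bound p; rewrite end_p sz_p /=; lia.
Qed.

(** The number of steps and the final height are at most [t], so the double sum misses no path; a
    path determines [s] and [j], so none is counted twice. *)
Lemma card_prefix_kfib_path t :
  #|` fset_set (prefix_kfib_path k t)| =
    \sum_(j < t.+1) \sum_(s < t.+1) size (paths s t j).
Proof.
set L := [seq p | u <- [seq (j, s) | j <- iota 0 t.+1, s <- iota 0 t.+1],
                  p <- paths u.2 t u.1].
have memL p : (p \in L) = (p \in fset_set (prefix_kfib_path k t)).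
  rewrite in_fset_set; last exact: finite_prefix_kfib_path.
  apply/allpairsPdep/idP => [[[j s] [q [_ /mem_paths[_ pos end_q] ->]]]|].
    by rewrite inE; split=> //; exists j%:Z.
  rewrite inE => -[pos [[] j // _ end_p]].
  have [] := endpoint_bound p; rewrite end_p /fst /snd => le1 le2.
  exists (j, size p), p; split=> //; last exact/mem_paths.
  by apply/allpairsPdep; exists j, (size p); rewrite !mem_iota; split=> //; lia.
have uL : uniq L.
  apply: allpairs_uniq_dep => [|u _|].
  - by apply: allpairs_uniq; rewrite ?iota_uniq // => -[? ?] [? ?].
  - exact: uniq_paths.
  move=> u v /flatten_mapP[[j s] _ /mapP[p /mem_paths[sz_p _ end_p] ->]].
  move=> /flatten_mapP[[j' s'] _ /mapP[q /mem_paths[sz_q _ end_q] ->]] /= eq_pq.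
  move: sz_p end_p; rewrite eq_pq sz_q end_q /= => eq_s [eq_j].
  by rewrite eq_s eq_j.
have -> : fset_set (prefix_kfib_path k t) = [fset p in L]%fset.
  by apply/fsetP => p; rewrite -memL in_fset.
rewrite card_fseq undup_id // size_allpairs_dep sumnE big_map big_allpairs.
rewrite -[iota 0 _]/(index_iota 0 t.+1) big_mkord.
by apply: eq_bigr => j _; rewrite big_mkord.
Qed.

Lemma size_pathsS s t j : size (paths s.+1 t j) =
  ((if t is u.+1 then
      (if j is i.+1 then size (paths s u i) else 0) + size (paths s u j.+1)
    else 0) + \sum_(l < t.+1) kfib k l * size (paths s (t - l) j))%N.
Proof.
rewrite /= size_allpairs_dep sumnE big_map big_cat big_cat /= big_allpairs_dep addnA.
congr (_ + _)%N.
  by case: t j => [|t] [|j]; rewrite /= ?big_cons ?big_nil ?subn1 ?addn0.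
rewrite -[iota 0 _]/(index_iota 0 t.+1) big_mkord; apply: eq_bigr => l _.
by rewrite /= big_const_seq iter_addn_0 count_predT size_enum_ord mulnC.
Qed.

(** * Generating functions and their functional equations *)

Definition paths_gf s j : fps rat := Fps (fun t => (size (paths s t j))%:R).

Definition kfib_gf : fps rat := Fps (fun l => (kfib k l)%:R).

Lemma kfib_gfE : kfib_gf * kfib_den k = fpsX.
Proof.
apply/fpsP => t; rewrite /kfib_den mulrC !mulrDl mul1r !mulNr -mulrA.
rewrite !fps_coefD !fps_coefN fps_coef_natM fps_coefXM fps_coefXnM /=.
case: t => [|[|t]]; rewrite ?mulr0 ?subrr ?subr0 //.
by rewrite kfibSS natrD natrM subn2 /=; ring.
Qed.

Lemma kfib_gfV : kfib_gf = fpsX / kfib_den k.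
Proof. by rewrite -kfib_gfE mulrK ?kfib_den_unit. Qed.

(** The value 0 at height 0 expresses that no rise comes from below the axis. *)
Definition shift_height (f : nat -> fps rat) (j : nat) : fps rat :=
  if j is i.+1 then f i else 0.

Lemma paths_gf0 j : paths_gf 0 j = (j == 0)%N%:R.
Proof.
apply/fpsP => t; rewrite /= size_nseq; case: j => [|j]; last by rewrite andbF.
by rewrite andbT.
Qed.

Lemma paths_gfS s j : paths_gf s.+1 j =
  fpsX * shift_height (paths_gf s) j + fpsX * paths_gf s j.+1
    + kfib_gf * paths_gf s j.
Proof.
apply/fpsP => t; rewrite !fps_coefD !fps_coefXM fps_coefM.
rewrite [LHS](congr1 (GRing.natmul 1) (size_pathsS s t j)) natrD.
rewrite natr_sum; under eq_bigr do rewrite natrM.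
by case: t j => [|t] [|j] /=; rewrite ?natrD ?add0r.
Qed.

Lemma coef_paths_gf_eq0 s t j : (t < s)%N || (s < j)%N ->
  '[z^t] (paths_gf s j) = 0.
Proof. by move=> out /=; rewrite paths_nil. Qed.

Definition height_gf j : fps rat := fps_sum (paths_gf ^~ j).

Lemma summable_paths_gf j : summable (paths_gf ^~ j).
Proof. by move=> s t lt_ts; rewrite coef_paths_gf_eq0 // lt_ts. Qed.

Lemma summable_height_gf : summable height_gf.
Proof.
move=> j t lt_tj; apply: big1 => s _; apply: coef_paths_gf_eq0.
by rewrite (leq_ltn_trans (leq_ord s) lt_tj) orbT.
Qed.

Lemma height_gfE j : height_gf j = (j == 0)%N%:R
  + fpsX * shift_height height_gf j + fpsX * height_gf j.+1
  + kfib_gf * height_gf j.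
Proof.
rewrite {1}/height_gf fps_sum_recl; last exact: summable_paths_gf.
rewrite paths_gf0 -!addrA; congr (_ + _).
have -> : shift_height height_gf j =
    fps_sum (fun s => shift_height (paths_gf s) j).
  by case: j => [|j] //; apply/fpsP => t; rewrite /= big1.
have sum_shift : summable (fun s => shift_height (paths_gf s) j).
  by case: j => [|j] // s t; exact: summable_paths_gf.
rewrite -!fps_sumM //; try exact: summable_paths_gf.
by rewrite -!fps_sumD; apply: eq_fps_sum => s; rewrite paths_gfS addrA.
Qed.

Lemma PT_fps_sum : PT k = fps_sum height_gf.
Proof.
apply/fpsP => t; rewrite /= card_prefix_kfib_path natr_sum.
by apply: eq_bigr => j _; rewrite natr_sum.
Qed.

Lemma PT_eq : PT k = 1 + fpsX * PT k + fpsX * (PT k - height_gf 0)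
  + kfib_gf * PT k.
Proof.
have sum_h := summable_height_gf; have sum_hS := summableS sum_h.
have PT_recl : PT k = height_gf 0 + fps_sum (fun j => height_gf j.+1).
  by rewrite PT_fps_sum fps_sum_recl.
(* The factor [fpsX] is essential: without it, entry [j.+1] is [height_gf j], whose coefficient at
   [j] is nonzero. *)
have sum_shift : summable (fun j => fpsX * shift_height height_gf j).
  case=> [|j] [|t] // lt_tj; rewrite fps_coefXM //.
  exact: sum_h.
have PT_shift : fpsX * PT k = fps_sum (fun j => fpsX * shift_height height_gf j).
  by rewrite fps_sum_recl // mulr0 add0r PT_fps_sum fps_sumM.
have PT_pos : PT k - height_gf 0 = fps_sum (fun j => height_gf j.+1).
  by rewrite PT_recl addrAC subrr add0r.
have one_sum : (1 : fps rat) = fps_sum (fun j => (j == 0)%N%:R).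
  apply/fpsP => t; rewrite /= big_ord_recl /= big1 => [|i _] //.
  by case: t => [|t]; rewrite ?addr0.
rewrite PT_pos PT_shift one_sum PT_fps_sum -!fps_sumM // -!fps_sumD.
by apply: eq_fps_sum => j; rewrite {1}height_gfE.
Qed.

(** Since [kfib_gf] has constant term 0, the coefficient at [t] on the right involves only
    coefficients below [t], so strong induction on [t] works for all heights at once. *)
Lemma height_recurrence_uniq (X : nat -> fps rat) :
  (forall j, X j = fpsX * shift_height X j + fpsX * X j.+1 + kfib_gf * X j) ->
  forall j, X j = 0.
Proof.
move=> eqX; suff X0 t : forall j, '[z^t] (X j) = 0 by move=> j; apply/fpsP.
elim/ltn_ind: t => t IHt j; rewrite eqX !fps_coefD !fps_coefXM fps_coefM.
rewrite big_ord_recl mul0r add0r big1 => [|i _]; last first.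
  by rewrite IHt ?mulr0 // lift0 ltn_subrL /= (leq_ltn_trans _ (ltn_ord i)).
by case: t IHt => [|t] IHt //; case: j => [|j]; rewrite /= ?IHt.
Qed.

(* The series z^j M^(j+1) solve the same recurrence in j as height_gf j. *)
Lemma height_gf0_eq (M : fps rat) :
  M = 1 + kfib_gf * M + fpsX ^+ 2 * M ^+ 2 -> height_gf 0 = M.
Proof.
move=> eqM; pose X j := height_gf j - fpsX ^+ j * M ^+ j.+1.
suff /(_ 0%N)/eqP : forall j, X j = 0.
  by rewrite /X subr_eq0 expr0 mul1r expr1 => /eqP.
apply: height_recurrence_uniq => -[|j]; rewrite /X {1}height_gfE /=.
  by rewrite !expr1 {1}eqM; ring.
by rewrite [M ^+ j.+2]exprS {1}eqM !exprS; ring.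
Qed.

(** * Weighted ballot numbers and coefficient extraction *)

(* Number of shapes (colors and lengths ignored) of paths with s steps, m of
   them falls, ending at height j. *)
Fixpoint ballot (s j m : nat) : nat :=
  if s is r.+1 then
    ((if j is i.+1 then ballot r i m else 0)
     + (if m is n.+1 then ballot r j.+1 n else 0) + ballot r j m)%N
  else ((j == 0) && (m == 0))%N.

(** Ending at height [j] after [m] falls takes [j + m] rises. *)
Lemma ballot_eq0 s j m : (s < j + 2 * m)%N -> ballot s j m = 0%N.
Proof.
elim: s j m => [|s IHs] [|j] [|m] //= lt_s; rewrite ?IHs //; lia.
Qed.

(** The weighted ballot formula without denominators: [l] counts the horizontal steps and [m + j]
    the rises. *)
Lemma ballot_fact s j m l : (j + 2 * m + l = s)%N ->
  (ballot s j m * (m`! * l`! * (m + j).+1`!) = j.+1 * s`!)%N.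
Proof.
elim: s j m l => [|s IHs] j m l.
  by case: j => [|j] //; case: m => [|m] //; case: l.
move=> def_s; rewrite /=.
have up : ((if j is i.+1 then ballot s i m else 0)
    * (m`! * l`! * (m + j)`!) = j * s`!)%N.
  by case: j def_s => [|j] def_s //; rewrite addnS IHs //; lia.
have down : ((if m is n.+1 then ballot s j.+1 n else 0)
    * (m`! * l`! * (m + j).+1`!) = m * j.+2 * s`!)%N.
  case: m def_s {up} => [|m] def_s //.
  rewrite -[RHS]mulnA -(IHs j.+1 m l); last by lia.
  by rewrite factS addnS addSn; ring.
have flat : (ballot s j m * (m`! * l`! * (m + j).+1`!) = l * j.+1 * s`!)%N.
  case: l def_s {up down} => [|l] def_s; first by rewrite ballot_eq0 //; lia.
  rewrite -[RHS]mulnA -(IHs j m l); last by lia.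
  by rewrite [l.+1`!]factS; ring.
(* The three cases add up by j(m+j+1) + m(j+2) + l(j+1) = (j+1)(j+2m+l), where the last factor is
   [s.+1]. *)
rewrite !mulnDl down flat [(m + j).+1`!]factS.
have -> : forall a x y z w, (a * (x * y * (z * w)) = z * (a * (x * y * w)))%N by lia.
rewrite up [s.+1`!]factS -def_s; lia.
Qed.

Lemma ballotE s j m l : (j + 2 * m + l = s)%N ->
  (ballot s j m)%:R = j.+1%:R / (j + m + 1)%:R * trinomial s m l (m + j) :> rat.
Proof.
move=> /ballot_fact/(congr1 (GRing.natmul (1 : rat))).
rewrite /trinomial factS addn1 [(j + m)%N]addnC !natrM => eq_b.
have fact_neq0 n : n`!%:R != 0 :> rat by rewrite pnatr_eq0 -lt0n fact_gt0.
have nz : (m`!%:R * l`!%:R * ((m + j).+1%:R * (m + j)`!%:R)) != 0 :> rat.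
  by rewrite !mulf_neq0 ?fact_neq0 // pnatr_eq0.
apply: (mulIf nz); rewrite eq_b; field.
by rewrite !fact_neq0 -natrD nat1r pnatr_eq0.
Qed.

(** The [j + 2 * m] rises and falls weigh z each, the remaining steps [kfib_gf] each. Where the
    subtraction truncates, [ballot] is 0. *)
Lemma paths_gf_ballot s j : paths_gf s j =
  \sum_(m < s.+1) (ballot s j m)%:R
     * (fpsX ^+ (j + 2 * m) * kfib_gf ^+ (s - (j + 2 * m))).
Proof.
elim: s j => [|s IHs] j.
  rewrite paths_gf0 big_ord1 sub0n addn0 expr0 mulr1 /= andbT.
  by case: j => [|j]; rewrite ?mul0r ?mulr1.
rewrite paths_gfS /=; under [RHS]eq_bigr do rewrite 2!natrD 2!mulrDl.
rewrite !big_split /=; congr (_ + _ + _).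
- case: j => [|j] /=; first by rewrite mulr0 big1 // => m _; rewrite mul0r.
  rewrite IHs [RHS]big_ord_recr /= [ballot s j s.+1]ballot_eq0; last by lia.
  rewrite mul0r addr0 mulr_sumr; apply: eq_bigr => m _.
  by rewrite addSn subSS exprS mulrCA !mulrA.
- rewrite IHs [RHS]big_ord_recl /= mul0r add0r mulr_sumr; apply: eq_bigr => m _.
  have -> : (j + 2 * bump 0 m = (j.+1 + 2 * m).+1)%N by rewrite /bump; lia.
  by rewrite subSS exprS mulrCA !mulrA.
rewrite IHs [RHS]big_ord_recr /= [ballot s j s.+1]ballot_eq0; last by lia.
rewrite mul0r addr0 mulr_sumr; apply: eq_bigr => m _.
have [lt_s|le_s] := ltnP s (j + 2 * m); first by rewrite ballot_eq0 // !mul0r mulr0.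
by rewrite subSn // exprS; ring.
Qed.

(** [kfib_gf ^+ l] is z^l / d^l, so the index drops by [n + l]; the final [+ 1] offsets the
    predecessor in [conv_kfib]. *)
Lemma coef_kfib_gf_exp n l t : (n + l <= t)%N ->
  '[z^t] (fpsX ^+ n * kfib_gf ^+ l) = conv_kfib k l (t - n - l + 1).
Proof.
move=> le_t; rewrite kfib_gfV exprMn exprVn mulrA -exprD fps_coefXnM le_t.
by rewrite /conv_kfib addn1 subnDA.
Qed.

Lemma coef_height_gf j t : '[z^t] (height_gf j) =
  \sum_(0 <= m < t.+1) \sum_(0 <= l < t.+1 - (2 * m + j))
    (ballot (j + 2 * m + l) j m)%:R * conv_kfib k l (t - 2 * m - j - l + 1).
Proof.
pose G s m := (ballot s j m)%:R * '[z^t] (fpsX ^+ (j + 2 * m)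
  * kfib_gf ^+ (s - (j + 2 * m))).
have G0 s m : (s < j + 2 * m)%N -> G s m = 0.
  by move=> lt_s; rewrite /G ballot_eq0 // mul0r.
transitivity (\sum_(s < t.+1) \sum_(m < t.+1) G s m).
  apply: eq_bigr => s _; rewrite paths_gf_ballot fps_coef_sum.
  under eq_bigr do rewrite fps_coef_natM -/(G _ _).
  rewrite (big_ord_widen t.+1 (G s)) // big_mkcond; apply: eq_bigr => m _.
  by case: ltnP => // lt_sm; rewrite G0 //; lia.
rewrite exchange_big big_mkord; apply: eq_bigr => m _.
rewrite -(big_mkord xpredT (G ^~ m)) [(2 * m + j)%N]addnC.
have [le_t|lt_t] := leqP (j + 2 * m) t; last first.
  rewrite (@big_geq _ _ _ _ (t.+1 - _)); last by lia.
  by rewrite big_nat big1 // => s /andP[_ lt_s]; rewrite G0 //; lia.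
(* Only s >= j + 2m contributes; there s = j + 2m + l. *)
rewrite (big_cat_nat (n := j + 2 * m)) //=; last by lia.
rewrite [X in X + _]big_nat big1 => [|s /andP[_]]; last exact: G0.
rewrite add0r -{1}[(j + 2 * m)%N]add0n big_addn [LHS]big_nat [RHS]big_nat.
apply: eq_bigr => l /andP[_ lt_l]; rewrite /G addnC addKn.
rewrite coef_kfib_gf_exp; last by lia.
by congr (_ * conv_kfib _ _ (_ - _ + _)); lia.
Qed.

End Paths.

(* The upper limit t.+1 - (2 * m + n) of the innermost sum makes it empty
   exactly when t < 2 * m + n, so that t - 2 * m - n - l + 1 only occurs when
   no subtraction is truncated. *)
Theorem theorem3p10 (k : nat) (hk : (0 < k)%N) :
  let z : fps rat := fpsX in
  let K : fps rat := k%:R in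
  tofrac (PT k) =
    tofrac ((1 - 2 * z) * (1 - K * z - z ^+ 2) - z
       - fps_sqrt ((1 - (K + 1) * z - z ^+ 2) ^+ 2
                   - 4 * z ^+ 2 * (1 - K * z - z ^+ 2) ^+ 2))
    / tofrac (2 * z * ((1 - K * z - z ^+ 2) * (2 * z - 1) + z))
    :> {fraction fps rat}
  /\
  forall t : nat,
    '[z^t] (PT k) =
      \sum_(0 <= n < t.+1) \sum_(0 <= m < t.+1)
        \sum_(0 <= l < t.+1 - (2 * m + n))
          n.+1%:R / (n + m + 1)%:R
          * trinomial (n + 2 * m + l) m l (m + n)
          * conv_kfib k l (t - 2 * m - n - l + 1).
Proof.
move=> z K; split=> [|t]; last first.
  (* [n] is the final height, [m] the number of falls, [l] that of horizontal steps. *)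
  rewrite PT_fps_sum big_mkord; apply: eq_bigr => n _; rewrite coef_height_gf.
  apply: eq_bigr => m _; apply: eq_bigr => l _.
  by rewrite (@ballotE _ _ _ l).
pose d := kfib_den k; rewrite -[1 - K * z - z ^+ 2]/d.
have -> : 1 - (K + 1) * z - z ^+ 2 = d - z by rewrite /d /kfib_den -/z -/K; ring.
set s := fps_sqrt _.
have coef0X (a : fps rat) : '[z^0] (z * a) = 0 by rewrite fps_coefXM.
have d0 : '[z^0] d = 1.
  by rewrite fps_coefD fps_coefD !fps_coefN mulrC expr2 !coef0X !subr0.
have dz0 : '[z^0] (d - z) = 1 by rewrite fps_coefD d0.
have s2 : s ^+ 2 = (d - z) ^+ 2 - 4 * z ^+ 2 * d ^+ 2.
  rewrite /s fps_sqrtK // [4 * _]mulrC expr2 -!mulrA fps_coefD fps_coefN.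
  by rewrite coef0X fps_coef0M dz0 mulr1 subr0.
have neq0 (a : fps rat) : '[z^0] a != 0 -> a != 0 by apply: contraNneq => ->.
have two_neq0 : (2 : fps rat) != 0 by apply: neq0; rewrite -[2]mulr1 fps_coef_natM.
(* [M] is the root (d - z - s) / (2 z^2 d) of its quadratic, rationalized by the conjugate [w] to
   avoid dividing by z. *)
pose w := d - z + s; pose M := 2 * d / w.
have w0 : '[z^0] w != 0 by rewrite /w fps_coefD fps_sqrt_coef0 dz0.
have [d_neq0 w_neq0] : d != 0 /\ w != 0 by split; apply: neq0; rewrite ?d0.
have Mw : M * w = 2 * d by rewrite /M divrK.
(* This relation eliminates [s]: multiplied by d w^2, the equation for [M] becomes polynomial in d,
   z and w. *)
have w2 : w ^+ 2 = 2 * (d - z) * w - 4 * z ^+ 2 * d ^+ 2.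
  by rewrite /w sqrrD s2; ring.
have hd := kfib_gfE k; rewrite -/d -/z in hd.
have height0 : height_gf k 0 = M.
  apply: height_gf0_eq; apply: (mulIf (mulf_neq0 d_neq0 (expf_neq0 2 w_neq0))).
  rewrite -/z; transitivity (M * w * d * w); first by ring.
  transitivity (d * w ^+ 2 + kfib_gf k * d * (M * w) * w
                + z ^+ 2 * d * (M * w) ^+ 2); last by ring.
  by rewrite Mw hd w2; ring.
have PTd : PT k * (d - 2 * z * d - z) = d - z * d * M.
  have := congr1 ( *%R^~ d) (PT_eq k); rewrite height0 -/z.
  set P := PT k => eqP.
  transitivity (P * d - (2 * z * d * P + (kfib_gf k * d) * P)).
    by rewrite hd; ring.
  by rewrite eqP; ring.
have z2dM : 2 * z ^+ 2 * d * M = d - z - s.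
  apply: (mulIf w_neq0); rewrite -[LHS]mulrA Mw.
  by transitivity ((d - z) ^+ 2 - s ^+ 2); [rewrite s2 | rewrite /w]; ring.
(* The factor z makes this a nonunit, hence the fraction field; the last factor has constant term
   -1. *)
have den_neq0 : 2 * z * (d * (2 * z - 1) + z) != 0.
  rewrite !mulf_neq0 //; first by apply/eqP => /fpsP/(_ 1%N).
  apply: neq0; rewrite fps_coefD fps_coef0M d0 mul1r fps_coefD.
  by rewrite [2 * z]mulrC coef0X.
apply: (canRL (mulfK _)); first by rewrite tofrac_eq0.
rewrite -tofracM; congr tofrac.
(* [d * (2 * z - 1) + z] is the opposite of the factor of [PT k] in [PTd]. *)
transitivity (- (2 * z) * (PT k * (d - 2 * z * d - z))); first by ring.
rewrite PTd; transitivity (2 * z ^+ 2 * d * M - 2 * z * d); first by ring.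
by rewrite z2dM; ring.
Qed.
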